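(* Let $X$ be a metrizable space. Then the following statements are equivalent: (i) $X$ admits a compatible metric $d$ such that $\tau_{AW_d}^+ = \min\{\tau_{AW_\rho}^+ : \rho \text{ is a compatible metric on } X\}$, i.e. $\tau_{AW_d}^+\subseteq \tau_{AW_\rho}^+$ on $CL(X)$ for every compatible metric $\rho$ on $X$; (ii) $X$ admits a compatible Heine-Borel metric.
   Context: All metric (metrizable) spaces have at least two points. A metric on a metrizable space $X$ is compatible if it induces the topology of $X$. $CL(X)$ is the set of nonempty closed subsets of $X$. For a metric $d$ on $X$, $d(x,A)=\inf\{d(x,a):a\in A\}$, and $\mathcal{B}_d(X)$ is the family of all nonempty $d$-bounded subsets of $X$. The upper Attouch-Wets topology $\tau_{AW_d}^+$ on $CL(X)$ is the topology having as neighborhood base at $A\in CL(X)$ the sets $\{C\in CL(X): d(x,A)-d(x,C)<\epsilon\ \forall x\in S\}$, where $S\in\mathcal{B}_d(X)$ and $\epsilon>0$. (So in $\tau_{AW_\rho}^+$ both the distance functionals and the family of bounded sets are those of $\rho$.) A compatible metric $d$ on $X$ is a Heine-Borel metric if all closed and $d$-bounded subsets of $X$ are compact. *)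

(* Defs.v *)
From HB Require Import structures.
From mathcomp Require Import all_boot all_order all_algebra.
From mathcomp Require Import all_classical all_reals all_analysis.

Set Implicit Arguments.
Unset Strict Implicit.
Unset Printing Implicit Defensive.

Import Order.TTheory GRing.Theory Num.Theory.

Local Open Scope classical_set_scope.
Local Open Scope ring_scope.

(* Metrics are first-class objects here, rather than instances of
   [metricType], since many metrics on one topological space are compared. *)
Record metric_on (R : realType) (X : Type) := MetricOn {
  metric_fun :> X -> X -> R;
  metric_fun_eq0 : forall x y, metric_fun x y = 0 <-> x = y;
  metric_fun_sym : forall x y, metric_fun x y = metric_fun y x;
  metric_fun_triangle : forall y x z,
    metric_fun x z <= metric_fun x y + metric_fun y z
}.

Section Metrics.
Context {R : realType}.

Definition metric_ball {X : Type} (d : metric_on R X) (x : X) (r : R) : set X :=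
  [set y | d x y < r].

Definition compatible {X : topologicalType} (d : metric_on R X) : Prop :=
  forall x : X, nbhs x = nbhs_ball_ (metric_ball d) x.

(* No nonemptiness requirement: the empty set is bounded. *)
Definition metric_bounded {X : Type} (d : metric_on R X) (S : set X) : Prop :=
  exists M : R, forall x y, S x -> S y -> d x y <= M.

Definition dist_to {X : Type} (d : metric_on R X) (x : X) (A : set X) : R :=
  inf [set d x a | a in A].

Definition Heine_Borel {X : topologicalType} (d : metric_on R X) : Prop :=
  forall K : set X, closed K -> metric_bounded d K -> compact K.

End Metrics.

Record CL (X : topologicalType) := MkCL {
  CL_set :> set X;
  CL_closed : closed CL_set;
  CL_neq0 : CL_set !=set0
}.

HB.instance Definition _ (X : topologicalType) := gen_eqMixin (CL X).
HB.instance Definition _ (X : topologicalType) := gen_choiceMixin (CL X).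

(* [CL X] equipped with the upper Attouch-Wets topology of [d]. *)
Definition upperAW {R : realType} {X : topologicalType} (d : metric_on R X) :=
  CL X.

Section UpperAttouchWets.
Context {R : realType} {X : topologicalType} (d : metric_on R X).

HB.instance Definition _ := Choice.on (upperAW d).

Definition upperAW_base (A : CL X) (S : set X) (e : R) : set (CL X) :=
  [set C : CL X | forall x, S x -> dist_to d x A - dist_to d x C < e].

Definition upperAW_nbhs (A : upperAW d) : set_system (upperAW d) :=
  filter_from
    [set p : set X * R | [/\ p.1 !=set0, metric_bounded d p.1 & 0 < p.2]]
    (fun p => upperAW_base A p.1 p.2).

Lemma metric_bounded_set1 (a : X) : metric_bounded d [set a].
Proof. by exists (d a a) => x y -> ->. Qed.

Lemma metric_boundedU (S T : set X) :
  metric_bounded d S -> metric_bounded d T -> metric_bounded d (S `|` T).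
Proof.
move=> [M bS] [N bT].
have [[s Ss]|/set0P/negP/negPn/eqP S0] := pselect (S !=set0); last first.
  by exists N => x y; rewrite S0 set0U; exact: bT.
have [[t Tt]|/set0P/negP/negPn/eqP T0] := pselect (T !=set0); last first.
  by exists M => x y; rewrite T0 setU0; exact: bS.
have d0 x y : 0 <= d x y.
  have dxx : d x x = 0 by apply/metric_fun_eq0.
  have := metric_fun_triangle d y x x.
  by rewrite dxx (metric_fun_sym d y x) -mulr2n pmulrn_lge0.
have M0 : 0 <= M by apply: le_trans (bS _ _ Ss Ss).
have N0 : 0 <= N by apply: le_trans (bT _ _ Tt Tt).
have cross x y : S x -> T y -> d x y <= M + d s t + N.
  move=> Sx Ty; apply: le_trans (metric_fun_triangle d t _ _) _.
  apply: lerD (bT _ _ Tt Ty).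
  by apply: le_trans (metric_fun_triangle d s _ _) _; rewrite lerD2r bS.
exists (M + d s t + N) => x y [Sx|Tx] [Sy|Ty].
- by apply: le_trans (bS _ _ Sx Sy) _; rewrite -addrA lerDl addr_ge0.
- exact: cross.
- by rewrite metric_fun_sym; exact: cross.
- by apply: le_trans (bT _ _ Tx Ty) _; rewrite lerDr addr_ge0.
Qed.

Lemma upperAW_nbhs_filter (A : upperAW d) : ProperFilter (upperAW_nbhs A).
Proof.
apply: filter_from_proper; last first.
  by move=> [S e] [_ _ /= e0]; exists A => x _; rewrite subrr.
apply: filter_from_filter.
  have [a _] := CL_neq0 A.
  by exists ([set a], 1); split => //=; [exists a|exact: metric_bounded_set1].
move=> [S e] [S' e'] [/= [s Ss] bS e0] [_ bS' /= e'0].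
exists (S `|` S', Num.min e e').
  split => /=; [by exists s; left|exact: metric_boundedU|].
  by rewrite lt_min e0 e'0.
move=> C AC; split => x Sx /=.
- by apply: lt_le_trans (AC x (or_introl Sx)) _; rewrite ge_min lexx.
- by apply: lt_le_trans (AC x (or_intror Sx)) _; rewrite ge_min lexx orbT.
Qed.

Lemma upperAW_nbhs_singleton (A : upperAW d) (U : set (upperAW d)) :
  upperAW_nbhs A U -> U A.
Proof. by move=> [[S e] [_ _ /= e0]]; apply => x _; rewrite subrr. Qed.

Lemma upperAW_nbhs_nbhs (A : upperAW d) (U : set (upperAW d)) :
  upperAW_nbhs A U -> upperAW_nbhs A (upperAW_nbhs ^~ U).
Proof.
move=> [[S e] [/= S0 bS e0] AU].
exists (S, e / 2); first by split => //=; rewrite divr_gt0.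
move=> C /= AC; exists (S, e / 2); first by split => //=; rewrite divr_gt0.
move=> D /= CD; apply: AU => x /= Sx.
by have := ltrD (AC x Sx) (CD x Sx); rewrite -splitr addrA subrK.
Qed.

HB.instance Definition _ := hasNbhs.Build (upperAW d) upperAW_nbhs.
HB.instance Definition _ := Nbhs_isNbhsTopological.Build (upperAW d)
  upperAW_nbhs_filter upperAW_nbhs_singleton upperAW_nbhs_nbhs.

End UpperAttouchWets.

(* Main.v *)
(* If [d] is minimal then [d] itself is a Heine-Borel metric.  Otherwise some
   closed [d]-bounded [K] is not compact, hence carries a continuous function
   [f] of [X] that is unbounded on [K], and [rho x y = d x y + |f x - f y|] is
   compatible.  For [f x] large, [{a, x}] is [rho]-Attouch-Wets close to [{a}]
   since [x] is [rho]-far from [a]; but it is not [d]-close, since [K] is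
   [d]-bounded and contains [x].
   Conversely, if [d] is Heine-Borel and [d x A - d x C >= e] for some [x] in a
   bounded set, then [C] contains a point [c] of a fixed compact ball with
   [d c A >= e / 2]; by compactness [rho c A] is then bounded below. *)
Require Import Defs.
From HB Require Import structures.
From mathcomp Require Import all_boot all_order all_algebra.
From mathcomp Require Import all_classical all_reals all_analysis.
From mathcomp Require Import lra.

Set Implicit Arguments.
Unset Strict Implicit.
Unset Printing Implicit Defensive.

Import Order.TTheory GRing.Theory Num.Theory.
Import numFieldNormedType.Exports.

Local Open Scope classical_set_scope.
Local Open Scope ring_scope.

(** * Distance functionals and bounded sets of one metric *)

Section MetricBasics.
Context {R : realType} {X : Type} (d : metric_on R X).

Lemma metric_funxx x : d x x = 0.
Proof. exact/metric_fun_eq0. Qed.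

Lemma metric_fun_ge0 x y : 0 <= d x y.
Proof.
have := metric_fun_triangle d y x x.
by rewrite metric_funxx (metric_fun_sym d y x); lra.
Qed.

Lemma dist_to_lbound x (A : set X) : lbound [set d x a | a in A] 0.
Proof. by move=> _ [a _ <-]; exact: metric_fun_ge0. Qed.

Lemma dist_to_ge0 x (A : set X) : A !=set0 -> 0 <= dist_to d x A.
Proof.
move=> [a Aa]; apply: lb_le_inf; first by exists (d x a), a.
exact: dist_to_lbound.
Qed.

Lemma dist_to_le x (A : set X) a : A a -> dist_to d x A <= d x a.
Proof.
move=> Aa; apply: ge_inf; last by exists a.
by exists 0; exact: dist_to_lbound.
Qed.

Lemma dist_to_lt x (A : set X) r : A !=set0 ->
  dist_to d x A < r -> exists2 a, A a & d x a < r.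
Proof.
move=> [a0 Aa0] /inf_lt[|_ [a Aa <-] axr]; first by exists (d x a0), a0.
by exists a.
Qed.

Lemma dist_to_in x (A : set X) : A x -> dist_to d x A = 0.
Proof.
move=> Ax; apply/eqP; rewrite eq_le dist_to_ge0 ?andbT; last by exists x.
by rewrite -(metric_funxx x) dist_to_le.
Qed.

Lemma dist_to_triangle y x (A : set X) : A !=set0 ->
  dist_to d x A <= d x y + dist_to d y A.
Proof.
move=> A0; apply/ler_addgt0Pr => e e0.
have [|a Aa ya] := @dist_to_lt y A (dist_to d y A + e) A0; first lra.
by have := dist_to_le x Aa; have := metric_fun_triangle d y x a; lra.
Qed.

Lemma metric_bounded_center (S : set X) a :
  metric_bounded d S -> exists M, forall x, S x -> d a x <= M.
Proof.
move=> [M bS]; have [[s Ss]|S0] := pselect (S !=set0).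
  exists (d a s + M) => x Sx.
  by apply: le_trans (metric_fun_triangle d s _ _) _; rewrite lerD2l bS.
by exists 0 => x Sx; case: S0; exists x.
Qed.

Lemma metric_bounded_ball a M : metric_bounded d [set x | d a x <= M].
Proof.
exists (M + M) => x y /= ax ay.
have := metric_fun_triangle d a x y.
by rewrite (metric_fun_sym d x a); lra.
Qed.

End MetricBasics.

(** * Continuity, compactness and perturbation of a compatible metric *)

Section Compatible.
Context {R : realType} {X : topologicalType} (d : metric_on R X).
Hypothesis dX : compatible d.

Lemma compatible_ball x e : 0 < e -> nbhs x [set y | d x y < e].
Proof. by move=> e0; rewrite dX; exists e. Qed.

Lemma lipschitz1_continuous (f : X -> R) :
  (forall x y, f x <= d x y + f y) -> continuous f.
Proof.
move=> fd x; apply/cvgrPdist_lt => e e0.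
apply: filterS (compatible_ball x e0) => y /= xy.
rewrite ltr_norml; have := fd x y; have := fd y x.
by rewrite (metric_fun_sym d y x); lra.
Qed.

Lemma continuous_metric_fun a : continuous (d a).
Proof.
apply: lipschitz1_continuous => x y; rewrite (metric_fun_sym d x y) addrC.
exact: metric_fun_triangle.
Qed.

Lemma continuous_dist_to (A : set X) : A !=set0 -> continuous (dist_to d ^~ A).
Proof.
by move=> A0; apply: lipschitz1_continuous => x y; exact: dist_to_triangle.
Qed.

Lemma dist_to_gt0 x (A : set X) :
  closed A -> A !=set0 -> ~ A x -> 0 < dist_to d x A.
Proof.
move=> cA A0 Ax; have : nbhs x (~` A).
  by apply: open_nbhs_nbhs; split=> //; exact: closed_openC.
rewrite dX => -[r /= r0 rA]; apply: lt_le_trans r0 _.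
rewrite leNgt; apply/negP => /(dist_to_lt A0)[a Aa /rA]; exact.
Qed.

Lemma closed_metric_ball a M : closed [set x | d a x <= M].
Proof.
apply: (@closed_comp _ _ (d a) [set r | r <= M]); last exact: closed_le.
by move=> x _; exact: continuous_metric_fun.
Qed.

(** The radius [d a x + 1] serves the whole unit ball around [x]; the near-covering form of
    compactness makes one radius serve all of [K]. *)
Lemma compact_metric_bounded (K : set X) : compact K -> metric_bounded d K.
Proof.
move=> cK; have [[a Ka]|K0] := pselect (K !=set0); last first.
  by exists 0 => x y Kx; case: K0; exists x.
have : \forall M \near +oo, K `<=` [set x | d a x <= M].
  apply: (compact_near_coveringP K).1 => // x Kx.
  exists ([set y | d x y < 1], [set M | d a x + 1 <= M]).
    by split; [exact: compatible_ball|exact: nbhs_pinfty_ge (num_real _)].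
  by move=> [y M] /= [xy aM]; have := metric_fun_triangle d x a y; lra.
move=> /filter_ex[M KM]; have [N bN] := metric_bounded_ball d a M.
by exists N => x y /KM Kx /KM; exact: bN.
Qed.

Section AddFunction.
Variable f : X -> R.

Let rho x y := d x y + `|f x - f y|.

Let rho_eq0 x y : rho x y = 0 <-> x = y.
Proof.
split=> [|->]; last by rewrite /rho metric_funxx subrr normr0 addr0.
move=> rho0; apply/(metric_fun_eq0 d); have := normr_ge0 (f x - f y).
by have := metric_fun_ge0 d x y; rewrite /rho in rho0; lra.
Qed.

Let rho_sym x y : rho x y = rho y x.
Proof. by rewrite /rho metric_fun_sym distrC. Qed.

Let rho_triangle y x z : rho x z <= rho x y + rho y z.
Proof.
by rewrite /rho addrACA lerD ?metric_fun_triangle// ler_distD.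
Qed.

Definition metric_add_fun := MetricOn rho_eq0 rho_sym rho_triangle.

Lemma compatible_metric_add_fun : continuous f -> compatible metric_add_fun.
Proof.
move=> cf x; apply/seteqP; split => U.
  rewrite dX => -[e e0 eU]; exists e => // y /= xy; apply: eU.
  by apply: le_lt_trans xy; rewrite lerDl.
move=> [e /= e0 eU]; have e20 : 0 < e / 2 by rewrite divr_gt0.
have /cvgrPdist_lt/(_ _ e20) fxe := cf x.
apply: filterS2 fxe (compatible_ball x e20) => y /= fxy xy.
by apply: eU; rewrite /metric_ball/= [e]splitr /rho addrC ltrD.
Qed.

End AddFunction.

End Compatible.

(** * Unbounded continuous functions on noncompact closed sets *)

Section UnboundedFunction.
Context {R : realType} {X : topologicalType} (d : metric_on R X).
Hypothesis dX : compatible d.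

(* [inf [set r | F (metric_ball d x r)]] is the limit of [d x] along the
   Cauchy ultrafilter [F]. *)
Lemma cauchy_ultra_unbounded (K : set X) (F : set_system X) :
  UltraFilter F -> F K -> (forall x : X, ~ F --> x) ->
  (forall e, 0 < e -> exists x, F (metric_ball d x e)) ->
  exists f : X -> R, continuous f /\ forall M, exists2 x, K x & M < f x.
Proof.
move=> FU FK Fnx Fcauchy.
pose L x := inf [set r | F (metric_ball d x r)].
have ball_gt0 x r : F (metric_ball d x r) -> 0 < r.
  by move=> /filter_ex[y]; exact: le_lt_trans (metric_fun_ge0 d x y).
have L_le x r : F (metric_ball d x r) -> L x <= r.
  by move=> Fxr; apply: ge_inf => //; exists 0 => s /ball_gt0/ltW.
have shift x y r : F (metric_ball d y r) -> F (metric_ball d x (d x y + r)).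
  apply: filterS => z; rewrite /metric_ball/= => yz.
  by have := metric_fun_triangle d y x z; lra.
have L_lt x r : L x < r -> F (metric_ball d x r).
  move=> /inf_lt[|s /= Fxs sr]; last first.
    by apply: filterS Fxs => z zs; exact: lt_trans sr.
  (* Being Cauchy makes the set under the infimum nonempty. *)
  have [y Fy] := Fcauchy 1 ltr01.
  by exists (d x y + 1); exact: shift.
have L_lip x y : L x <= d x y + L y.
  apply/ler_addgt0Pr => e e0; rewrite -addrA; apply/L_le/shift/L_lt.
  by rewrite ltrDl.
have L_gt0 x : 0 < L x.
  rewrite ltNge; apply/negP => Lx; apply: (Fnx x) => U.
  rewrite dX => -[e /= e0 eU]; apply: filterS eU _.
  by apply: L_lt; exact: le_lt_trans e0.
(* [L] is positive and 1-Lipschitz, so its inverse is continuous; [L] is small on the small balls of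
   [F], which all meet [K]. *)
exists (fun x => (L x)^-1); split=> [x|M].
  apply: cvgV; first by rewrite gt_eqF.
  exact: (lipschitz1_continuous dX L_lip).
pose e := (`|M| + 1)^-1.
have e0 : 0 < e by rewrite invr_gt0 ltr_wpDl.
have e40 : 0 < e / 4 by rewrite divr_gt0.
have [x Fx] := Fcauchy _ e40.
have [y [Ky xy]] := filter_ex (filterI FK Fx).
exists y => //; apply: (@lt_trans _ _ (`|M| + 1)).
  by have := ler_norm M; lra.
rewrite -[_ + 1]invrK ltf_pV2 ?posrE//.
apply: (@le_lt_trans _ _ (d y x + e / 4)); first exact/L_le/shift.
by rewrite metric_fun_sym; rewrite /metric_ball/= in xy; rewrite -/e; lra.
Qed.

(** Put at each [x_ n] a bump of height [n * e] supported within [e / 4]. Since the balls of radius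
    [e / 2] around the [x_ n] are disjoint, at most one bump matters near any point. *)
Lemma separated_unbounded (K : set X) (x_ : nat -> X) e :
  0 < e -> (forall n, K (x_ n)) ->
  (forall m n, (m < n)%N -> e <= d (x_ m) (x_ n)) ->
  exists f : X -> R, continuous f /\ forall M, exists2 x, K x & M < f x.
Proof.
move=> e0 Kx sep.
have uniq_near y m n : d y (x_ m) < e / 2 -> d y (x_ n) < e / 2 -> m = n.
  move=> ym yn; have mn : d (x_ m) (x_ n) < e.
    have := metric_fun_triangle d y (x_ m) (x_ n).
    by rewrite (metric_fun_sym d (x_ m) y); lra.
  have [/sep|/sep|//] := ltngtP m n; first by rewrite leNgt mn.
  by rewrite metric_fun_sym leNgt mn.
(* The default index 0, taken away from all the balls, is harmless: [bump 0] is identically 0. *)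
pose N y := xget 0%N [set n | d y (x_ n) < e / 2].
have NE y n : d y (x_ n) < e / 2 -> N y = n.
  move=> yn; apply: (@uniq_near y) => //.
  by apply: (@xgetPex _ 0%N [set n | d y (x_ n) < e / 2]); exists n.
pose bump n y := n%:R * Num.max 0 (e - 4 * d y (x_ n)).
exists (fun y => bump (N y) y); split=> [y|M].
  have [[n yn]|far] := pselect (exists n, d y (x_ n) < e / 2).
    have r0 : 0 < e / 2 - d y (x_ n) by rewrite subr_gt0.
    have Nn : \forall z \near y, bump n z = bump (N z) z.
      apply: filterS (compatible_ball dX y r0) => z /= yz; rewrite (NE z n)//.
      have := metric_fun_triangle d y z (x_ n).
      by rewrite (metric_fun_sym d z y); lra.
    rewrite /continuous_at (NE y n yn); apply: cvg_trans (near_eq_cvg Nn) _.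
    apply: cvgM; first exact: cvg_cst.
    apply: (@continuous_max _ X (cst 0) (fun z => e - 4 * d z (x_ n)) y).
      exact: cvg_cst.
    apply: cvgB; first exact: cvg_cst.
    apply: cvgM; first exact: cvg_cst.
    rewrite metric_fun_sym (_ : d ^~ (x_ n) = d (x_ n)); last first.
      by apply/funext => z; exact: metric_fun_sym.
    exact: (continuous_metric_fun dX).
  (* If every [x_ n] is at least [e / 2] away from [y], then all bumps vanish on the [e / 4]-ball of
     [y]. *)
  have bump0 n z : d y z < e / 4 -> bump n z = 0.
    move=> yz; rewrite /bump max_l ?mulr0//.
    have : e / 2 <= d y (x_ n).
      by rewrite leNgt; apply/negP => yn; apply: far; exists n.
    by have := metric_fun_triangle d z y (x_ n); lra.
  rewrite /continuous_at bump0 ?metric_funxx ?divr_gt0//; apply: cvg_near_cst.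
  have e40 : 0 < e / 4 by rewrite divr_gt0.
  by apply: filterS (compatible_ball dX y e40) => z; exact: bump0.
(* The bump at [x_ n] takes the value [n * e] there, so [n] has to exceed [M / e]. *)
pose n := (Num.trunc (`|M| / e)).+1.
exists (x_ n) => //; rewrite (NE _ n) ?metric_funxx ?divr_gt0//.
rewrite /bump metric_funxx mulr0 subr0 max_r ?(ltW e0)//.
rewrite -ltr_pdivrMr//; apply: (@le_lt_trans _ _ (`|M| / e)).
  by rewrite ler_pM2r ?invr_gt0// ler_norm.
by rewrite truncnS_gt.
Qed.

(** The complement of every [e]-ball lies in the ultrafilter, so [K] minus finitely many such balls
    is nonempty and the next point can be chosen there. *)
Lemma ultra_separated_seq (K : set X) (F : set_system X) e :
  UltraFilter F -> F K -> (forall x, ~ F (metric_ball d x e)) ->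
  exists x_ : nat -> X, (forall n, K (x_ n)) /\
    forall m n, (m < n)%N -> e <= d (x_ m) (x_ n).
Proof.
move=> FU FK Fball.
have next (s : seq X) : exists y, K y /\ forall x, x \in s -> e <= d x y.
  suff /filter_ex[y [Ky sy]] :
      F (K `&` [set y | forall x, x \in s -> e <= d x y]) by exists y.
  apply: filterI => //; elim: s => [|x s IHs].
    by apply: filterS FK => y _ x; rewrite in_nil.
  have [/Fball []|Fx] := in_ultra_setVsetC (metric_ball d x e) FU.
  apply: filterS2 IHs Fx => y sy /negP xy z; rewrite in_cons => /predU1P[->|].
    by rewrite leNgt.
  exact: sy.
have [c cP] := choice next.
(* [s_ n] lists the first [n] points, latest first; the next point is [c (s_ n)]. *)
pose s_ n := iter n (fun s => c s :: s) [::].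
have in_s m n : (m < n)%N -> c (s_ m) \in s_ n.
  elim: n => // n IHn; rewrite ltnS leq_eqVlt /= in_cons => /predU1P[->|/IHn->].
    by rewrite eqxx.
  by rewrite orbT.
exists (c \o s_); split=> [n|m n /in_s mn] /=; first exact: (cP _).1.
exact: (cP _).2.
Qed.

Lemma noncompact_unbounded (K : set X) : closed K -> ~ compact K ->
  exists f : X -> R, continuous f /\ forall M, exists2 x, K x & M < f x.
Proof.
move=> cK; rewrite compact_ultra => /existsNP[F].
move=> /not_implyP[FU /not_implyP[FK Fnlim]].
have Fnx (x : X) : ~ F --> x.
  move=> Fx; apply: Fnlim; exists x; split=> //; apply: contrapT => Kx.
  have /Fx FKC : nbhs x (~` K).
    by apply: open_nbhs_nbhs; split=> //; exact: closed_openC.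
  by have [y []] := filter_ex (filterI FK FKC).
(* Either the ultrafilter is Cauchy, or it contains no ball of some radius [e] and yields an
   [e]-separated sequence in [K]. *)
have [|] := pselect (forall e, 0 < e -> exists x, F (metric_ball d x e)).
  exact: cauchy_ultra_unbounded.
move=> /existsNP[e /not_implyP[e0 Fball]].
have {}Fball x : ~ F (metric_ball d x e) by move=> Fx; apply: Fball; exists x.
have [x_ [Kx sep]] := ultra_separated_seq FU FK Fball.
exact: separated_unbounded sep.
Qed.

End UnboundedFunction.

(** * Minimality against the Heine-Borel property *)

Section Comparison.
Context {R : realType} {X : topologicalType} (d : metric_on R X).
Hypothesis dX : compatible d.

Lemma minimal_Heine_Borel :
  (forall rho : metric_on R X, compatible rho -> forall U : set (CL X),
     @open (upperAW d) U -> @open (upperAW rho) U) ->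
  Heine_Borel d.
Proof.
move=> dmin K cK bK; apply: contrapT => ncK.
have [f [cf fK]] := noncompact_unbounded dX cK ncK.
have [a _ _] := fK 0.
have closed1 (x : X) : closed [set x].
  rewrite (_ : [set x] = [set y | d x y <= 0]); first exact: closed_metric_ball.
  apply/seteqP; split=> [y ->/=|y /= xy]; first by rewrite metric_funxx.
  apply/esym/(metric_fun_eq0 d)/eqP; rewrite eq_le xy /=.
  exact: metric_fun_ge0.
pose A : CL X := MkCL (closed1 a) (ex_intro [set a] a erefl).
(* Near [a] the function [f] is bounded, so [f x] large keeps [x] away from
   [a]. *)
have [e /= e0 fa] : exists2 e, 0 < e & forall x, d a x < e -> f x <= f a + 1.
  have /cvgrPdist_lt/(_ 1 ltr01) := cf a.
  rewrite {1}dX => -[e /= e0 fa]; exists e => // x /fa /=.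
  by rewrite ltr_norml; lra.
pose rho := metric_add_fun d f.
have rhoX : compatible rho := compatible_metric_add_fun dX cf.
(* A basic neighborhood need not be open, so its interior is compared instead. *)
pose U : set (upperAW d) := @interior (upperAW d) (upperAW_base d A K e).
have Uopen : @open (upperAW rho) U by apply: dmin => //; exact: open_interior.
have K0 : K !=set0 by have [x Kx _] := fK 0; exists x.
have UA : U A by exists (K, e).
have [[S e'] [/= S0 bS e'0] SU] : @upperAW_nbhs R X rho A U.
  by apply: (@open_nbhs_nbhs (upperAW rho)); split.
have [M SM] := metric_bounded_center a bS.
(* This bound gives [f x > f a + 1], so [x] is [e]-far from [a], and [rho a x >= M + M], so points
   of [S], being within [M] of [a], are no closer to [x] than to [a]. *)
have [x Kx fx] := fK (`|f a| + 1 + M + M).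
have M0 : 0 <= M.
  by have [s /SM] := S0; apply: le_trans; exact: metric_fun_ge0.
pose C : CL X := MkCL (closedU (closed1 a) (closed1 x))
  (ex_intro _ a (or_introl erefl)).
have UC : U C.
  apply: SU => s Ss; rewrite (le_lt_trans _ e'0)// subr_le0.
  have sa : dist_to rho s A <= rho s a by exact: dist_to_le.
  apply: lb_le_inf; first by exists (rho s a), a => //; left.
  move=> _ [c [->|->] <-] //.
  apply: le_trans sa _; have aS := SM _ Ss.
  have ax : M + M <= rho a x.
    have := metric_fun_ge0 d a x; have := ler_norm (f x - f a).
    by rewrite /rho /= distrC; have := ler_norm (f a); lra.
  have := metric_fun_triangle rho s a x.
  by rewrite (metric_fun_sym rho s a); lra.
have /(_ x Kx) : upperAW_base d A K e C.
  exact: (@interior_subset (upperAW d)) UC.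
rewrite (@dist_to_in _ _ d x C); last by right.
rewrite subr0 => /(dist_to_lt (CL_neq0 A))[_ -> xa].
have := fa x; rewrite metric_fun_sym => /(_ xa).
by have := ler_norm (f a); lra.
Qed.

Lemma Heine_Borel_minimal (rho : metric_on R X) :
  compatible rho -> Heine_Borel d -> forall U : set (CL X),
  @open (upperAW d) U -> @open (upperAW rho) U.
Proof.
move=> rhoX HB U; rewrite !openE => oU.
suff nbhsU (A : CL X) : U A -> @upperAW_nbhs R X rho A U by exact: nbhsU.
move=> /oU[[S e] [/= [s Ss] bS e0] SU].
have A0 := CL_neq0 A.
have [M SM] := metric_bounded_center s bS.
(* For [x] in [S], a point [c] with [d x c < dist_to d x A] satisfies [d s c <= N], as
   [dist_to d x A <= M + dist_to d s A]. *)
pose N := M + (dist_to d s A + M).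
pose B := [set x | d s x <= N].
have cB : compact B.
  by apply: HB; [exact: closed_metric_ball|exact: metric_bounded_ball].
(* Points of [B] at [d]-distance at least [e / 2] from [A] stay uniformly
   [rho]-away from [A]. *)
have : \forall r \near 0^'+,
    B `<=` [set x | e / 2 <= dist_to d x A -> r <= dist_to rho x A].
  apply: (compact_near_coveringP B).1 => // x Bx.
  (* Near a point of [A] the premise [e / 2 <= dist_to d y A] fails; near any other [x], half of the
     positive [dist_to rho x A] is a lower bound. *)
  have [Ax|Ax] := pselect (CL_set A x).
    have e20 : 0 < e / 2 by rewrite divr_gt0.
    exists ([set y | d x y < e / 2], setT).
      by split; [exact: compatible_ball|exact: filterT].
    move=> [y r] /= [xy _]; have := dist_to_le d y Ax.
    by rewrite metric_fun_sym; lra.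
  have xA := dist_to_gt0 rhoX (@CL_closed _ A) A0 Ax.
  have r0 : 0 < dist_to rho x A / 2 by rewrite divr_gt0.
  exists ([set y | rho x y < dist_to rho x A / 2],
          [set r | r <= dist_to rho x A / 2]).
    by split; [exact: compatible_ball|exact: nbhs_right_le].
  by move=> [y r] /= [xy ry] _; have := dist_to_triangle rho y x A0; lra.
move=> /(filterI (nbhs_right_gt 0))/filter_ex[r [/= r0 Br]].
exists (B, r).
  split => //=; last exact: compact_metric_bounded.
  exists s; rewrite /B /= metric_funxx.
  have := SM _ Ss; have := dist_to_ge0 d s A0; have := metric_fun_ge0 d s s.
  by rewrite /N; lra.
(* A violation at [x] yields [c] in both [C] and [B] with [dist_to rho c A >= r], while
   [dist_to rho c C = 0], against the choice of [C]. *)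
move=> C /= BC; apply: SU => x /= Sx; rewrite ltNge; apply/negP => eAC.
have C0 := CL_neq0 C.
have [|c Cc xc] := @dist_to_lt _ _ d x C (dist_to d x A - e / 2) C0; first lra.
have sx := SM _ Sx.
have Bc : B c.
  have := metric_fun_triangle d x s c; have := dist_to_triangle d s x A0.
  by rewrite (metric_fun_sym d x s) /B /= /N; lra.
have /(Br c Bc) : e / 2 <= dist_to d c A.
  by have := dist_to_triangle d c x A0; lra.
by have := BC c Bc; rewrite (dist_to_in rho Cc) /=; lra.
Qed.

End Comparison.

Theorem theorem5p7 (R : realType) (X : topologicalType)
    (X_two_points : exists x y : X, x <> y)
    (X_metrizable : exists d : metric_on R X, compatible d) :
  (exists d : metric_on R X, compatible d /\
     forall rho : metric_on R X, compatible rho ->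
       forall U : set (CL X),
         @open (upperAW d) U -> @open (upperAW rho) U) <->
  (exists d : metric_on R X, compatible d /\ Heine_Borel d).
Proof.
split=> -[d [dX dP]]; exists d; split=> //; first exact: minimal_Heine_Borel.
by move=> rho rhoX; exact: Heine_Borel_minimal.
Qed.
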